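(* For any integer $M\ge2$, the Hausdorff dimension of the set of simple $M$-renormalizable parameter angles $\theta\in\mathbb{S}^1$, as well as the Hausdorff dimension of the set of simple $M$-renormalizable kneading sequences, is at most $1/M$. The Hausdorff dimension of the set of infinitely renormalizable parameter angles, as well as that of the set of infinitely renormalizable kneading sequences, is $0$.
   Context: $\mathbb{S}^1=\mathbb{R}/\mathbb{Z}$, $D(\varphi)=2\varphi \bmod 1$. For $\theta\in[0,1)$, the kneading sequence $\nu(\theta)=\nu_1\nu_2\ldots$ has $\nu_k=0$ if $D^{\circ(k-1)}(\theta)\in(\frac{1+\theta}{2},\frac{\theta}{2})$, $\nu_k=1$ if $D^{\circ(k-1)}(\theta)\in(\frac{\theta}{2},\frac{1+\theta}{2})$, $\nu_k=\star$ if $D^{\circ(k-1)}(\theta)\in\{\frac{\theta}{2},\frac{1+\theta}{2}\}$ (intervals with respect to cyclic order). In general, a kneading sequence is a sequence in $\{0,1\}^{\{1,2,3,\ldots\}}$ with first entry $1$, or a $\star$-periodic sequence $\overline{\nu_1\ldots\nu_{n-1}\star}$ with $n\ge2$, $\nu_1=1$, $\nu_i\in\{0,1\}$ (whether or not it is realized by an angle). The Hausdorff dimension of a set $Y$ of $0$-$1$-sequences is that of its image in $\mathbb{S}^1$ under $x_1x_2\ldots\mapsto\sum_i x_i2^{-i}$ (the countably many $\star$-periodic sequences are irrelevant for dimension). For a kneading sequence $\nu$ let $\rho_\nu(n)=\inf\{k>n:\nu_k\ne\nu_{k-n}\}\in\{1,2,\ldots\}\cup\{\infty\}$. The internal address of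 $\nu$ is $1=S_0\to S_1\to S_2\to\cdots$ with $S_{j+1}=\rho_\nu(S_j)$, ending at $S_j$ if $\rho_\nu(S_j)=\infty$. A kneading sequence is simple $M$-renormalizable if $M=S_k$ is an entry of its internal address and all later entries $S_j$, $j\ge k$, are multiples of $M$. (This is the combinatorial counterpart of simple renormalizability of period $M$ of $z\mapsto z^2+c$: existence of neighborhoods $U\Subset V$ of $0$ such that $p_c^{\circ M}:U\to V$ is a degree-$2$ branched cover with $p_c^{\circ iM}(0)\in U$ for all $i\ge 1$, whose little filled-in Julia set $K_U$ is not disconnected by $K_U\cap p_c^{\circ i}(K_U)$, $1\le i\le M-1$.) A parameter angle $\theta\ne 0$ is simple $M$-renormalizable if $\nu(\theta)$ is. A kneading sequence or parameter angle is infinitely renormalizable if it is simple $M$-renormalizable for arbitrarily large $M$. *)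

(* Defs.v *)
From HB Require Import structures.
From mathcomp Require Import all_boot all_order all_algebra.
From mathcomp Require Import all_classical all_reals all_analysis.
From mathcomp Require Import ring lra.

Set Implicit Arguments.
Unset Strict Implicit.
Unset Printing Implicit Defensive.

Import Order.TTheory GRing.Theory Num.Theory.
Import numFieldNormedType.Exports.

Local Open Scope classical_set_scope.
Local Open Scope ring_scope.

Section HausdorffDimension.
Context {R : realType} {T : metricType R}.
Implicit Types (A U : set T) (s delta : R).
Local Open Scope ereal_scope.

(* The diameter of the empty set is -oo; only [diam_pow] and the bound by
   [delta > 0] below see it. *)
Definition diam U : \bar R := ereal_sup [set (mdist x y)%:E | x in U & y in U].

(* [0 `^ 0 = 1], so the empty set has to be singled out for [s = 0]. *)
Definition diam_pow s U : \bar R := if U == set0 then 0 else diam U `^ s.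

Definition hausdorff_premeasure s delta A : \bar R :=
  ereal_inf [set \sum_(i <oo) diam_pow s (U i) | U in
    [set U : nat -> set T |
      A `<=` \bigcup_i U i /\ forall i, diam (U i) <= delta%:E]].

(* The premeasures increase as [delta] decreases to 0, so that their limit is
   a supremum. *)
Definition hausdorff_measure s A : \bar R :=
  ereal_sup [set hausdorff_premeasure s delta A | delta in
    [set delta : R | (0 < delta)%R]].

Definition hausdorff_dim A : \bar R :=
  ereal_inf [set s%:E | s in
    [set s : R | (0 <= s)%R /\ hausdorff_measure s A = 0]].

End HausdorffDimension.

Definition frac_part {R : realType} (x : R) : R := x - (Num.floor x)%:~R.

Lemma frac_part_itv {R : realType} (x : R) : 0 <= frac_part x < 1.
Proof.
have /andP[h1 h2] := floor_itv x.
by rewrite /frac_part subr_ge0 h1 /= ltrBlDl -intrD1.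
Qed.

(* R/Z, each class being represented by its element of [0, 1) *)
Record circle (R : realType) :=
  Circle { angle :> R; angle_itv : 0 <= angle < 1 }.

HB.instance Definition _ (R : realType) := [isSub for @angle R].
HB.instance Definition _ (R : realType) := [Choice of circle R by <:].

Definition to_circle {R : realType} (x : R) : circle R := Circle (frac_part_itv x).

Section CircleMetric.
Context {R : realType}.
Implicit Types x y z : circle R.

(* quotient metric of R/Z *)
Definition circle_dist x y : R :=
  Num.min `|angle x - angle y| (1 - `|angle x - angle y|).

Lemma circle_distxx x : circle_dist x x = 0.
Proof. by rewrite /circle_dist subrr normr0 subr0 min_l. Qed.

Lemma circle_dist_eq0 x y : circle_dist x y = 0 -> x = y.
Proof.
move: (angle_itv x) (angle_itv y) => /andP[x0 x1] /andP[y0 y1] h.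
apply: val_inj => /=; move: h; rewrite /circle_dist minElt.
by case: ifPn; case: (lerP (angle y) (angle x)) => ?; lra.
Qed.

Lemma circle_dist_sym x y : circle_dist x y = circle_dist y x.
Proof. by rewrite /circle_dist distrC. Qed.

Lemma circle_dist_triangle y x z :
  circle_dist x z <= circle_dist x y + circle_dist y z.
Proof.
move: (angle_itv x) (angle_itv y) (angle_itv z).
move=> /andP[x0 x1] /andP[y0 y1] /andP[z0 z1].
have h1 := ler_distD (angle y) (angle x) (angle z).
have h2 := ler_distD (angle z) (angle x) (angle y).
have h3 := ler_distD (angle x) (angle y) (angle z).
have h4 : `|angle x - angle y| + `|angle y - angle z| + `|angle x - angle z| <= 2.
  by case: (lerP (angle y) (angle x)) => ?; case: (lerP (angle z) (angle y)) => ?;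
    case: (lerP (angle z) (angle x)) => ?; lra.
rewrite (distrC (angle z)) in h2; rewrite (distrC (angle y) (angle x)) in h3.
rewrite /circle_dist; move: h1 h2 h3 h4.
move: `|angle x - angle y| `|angle y - angle z| `|angle x - angle z| => b c a.
move=> h1 h2 h3 h4; rewrite ge_min; apply/orP; rewrite !minElt.
by case: ifPn => _; case: ifPn => _; first [left; lra | right; lra].
Qed.

HB.instance Definition _ := @isMetric.Build R (circle R) circle_dist
  circle_distxx circle_dist_eq0 circle_dist_sym circle_dist_triangle.

End CircleMetric.

Section Kneading.

(* A sequence x_1 x_2 ... is stored with x_1 at index 0. *)
Definition entry {A : Type} (x : nat -> A) (k : nat) : A := x k.-1.

(* [Some false], [Some true] and [star] stand for 0, 1 and the star. *)
Definition symbol := option bool.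
Definition star : symbol := None.

Implicit Types (nu : nat -> symbol) (M : nat).

Definition kneading_sequence nu : Prop :=
  entry nu 1 = Some true /\
  ((forall k, (1 <= k)%N -> entry nu k != star) \/
   (exists n, [/\ (2 <= n)%N,
      (forall k, (1 <= k < n)%N -> entry nu k != star),
      entry nu n = star &
      (forall k, (1 <= k)%N -> entry nu (k + n) = entry nu k)])).

(* [None] is the value infinity. *)
Definition rho nu (n : nat) : option nat :=
  if pselect (exists k, (n < k)%N && (entry nu k != entry nu (k - n)))
    is left H then Some (ex_minn H) else None.

(* [internal_address nu j = Some S_j], or [None] if the internal address ends
   before its [j]-th entry. *)
Definition internal_address nu (j : nat) : option nat :=
  iter j (obind (rho nu)) (Some 1%N).

Definition simple_renormalizable M nu : Prop :=
  exists k, internal_address nu k = Some M /\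
    forall j n, (k <= j)%N -> internal_address nu j = Some n -> (M %| n)%N.

Definition infinitely_renormalizable nu : Prop :=
  forall N, exists M, (N <= M)%N /\ simple_renormalizable M nu.

Definition renormalizable_sequences M : set (nat -> symbol) :=
  [set nu | kneading_sequence nu /\ simple_renormalizable M nu].

Definition infinitely_renormalizable_sequences : set (nat -> symbol) :=
  [set nu | kneading_sequence nu /\ infinitely_renormalizable nu].

End Kneading.

Section Angles.
Context {R : realType}.
Implicit Types (a b x theta : circle R) (M : nat).

(* open arc from [a] to [b] in the positive cyclic order *)
Definition in_arc a b x : bool :=
  0 < frac_part (angle x - angle a) < frac_part (angle b - angle a).

Definition doubling x : circle R := to_circle (2 * angle x).

Definition itinerary_symbol theta x : symbol :=
  let a := to_circle (angle theta / 2) in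
  let b := to_circle ((1 + angle theta) / 2) in
  if in_arc b a x then Some false
  else if in_arc a b x then Some true
  else (* x = a or x = b *) star.

Definition kneading theta : nat -> symbol :=
  fun i => itinerary_symbol theta (iter i doubling theta).

Definition renormalizable_angles M : set (circle R) :=
  [set theta | theta != to_circle 0 /\ simple_renormalizable M (kneading theta)].

Definition infinitely_renormalizable_angles : set (circle R) :=
  [set theta | theta != to_circle 0 /\ infinitely_renormalizable (kneading theta)].

Definition binary_angle (x : nat -> bool) : circle R :=
  to_circle (limn (fun n => \sum_(1 <= k < n) (entry x k)%:R * 2 ^- k : R)).

End Angles.

(* Dimension of the set of the star-free sequences in [Y]. *)
Definition sequence_dim (R : realType) (Y : set (nat -> symbol)) : \bar R :=
  @hausdorff_dim R (circle R)
    [set binary_angle x | x in [set x | Y (fun i => Some (x i))]].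

(* Main.v *)
(* If M is an entry of the internal address and all later entries are multiples
   of M, then the symbols at the places not divisible by M are periodic of
   period M, so that only one symbol out of M is free. For sequences this gives
   a cover by about 2^N intervals of length 2^(-NM), hence the bound 1/M.

   For an angle theta with orbit x_n, the n-th binary digit is determined by the
   n-th symbol and by the order of x_n and theta. If x_k came arbitrarily close
   to theta for some k not divisible by M, the first M symbols would be
   invariant under the cyclic shift by k, which is impossible for an entry M of
   the internal address. Hence theta can be replaced by a rational t in these
   comparisons, and for fixed t each of the M - 1 constrained steps adds only
   two new intervals, those adjacent to t, whereas a free step doubles their
   number. There are countably many pairs (t, word of length M).

   That M cannot be an entry when the sequence has a period g <= M / 2 as well
   follows by ordering the shifts lexicographically by their addresses:
   following the address of the sequence through the times k and k + g exhibits,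
   for every shift k < g, another one that is strictly larger. *)

Require Import Defs.
From mathcomp Require Import all_boot all_order all_algebra.
From mathcomp Require Import all_classical all_reals all_analysis.
From mathcomp Require Import zify ring lra.

Set Implicit Arguments.
Unset Strict Implicit.
Unset Printing Implicit Defensive.

Import Order.TTheory GRing.Theory Num.Theory.
Import numFieldNormedType.Exports.

Local Open Scope classical_set_scope.
Local Open Scope ring_scope.

(** * Internal addresses of periodic sequences *)

Section Address.
Local Open Scope nat_scope.
Context {T : eqType}.
Implicit Types (f : nat -> T) (k n : nat).

(* The last entry not exceeding [n] of the internal address of the sequence [f]
   shifted by [k], computed relative to [f]; [k = 0] is the usual internal
   address. Positions are 1-based: the [n]-th symbol of [f] is [f n.-1]. *)
Fixpoint last_entry f k n : nat :=
  if n is m.+1 then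
    if (m == 0) || (f (k + m) != f (m - last_entry f k m)) then n
    else last_entry f k m
  else 0.

Lemma last_entryS f k n : 0 < n ->
  last_entry f k n.+1 =
    if f (k + n) != f (n - last_entry f k n) then n.+1 else last_entry f k n.
Proof. by case: n. Qed.

Lemma last_entry_le f k n : last_entry f k n <= n.
Proof. by elim: n => //= n IH; case: ifP => // _; exact: leq_trans IH _. Qed.

Lemma last_entry_gt0 f k n : 0 < n -> 0 < last_entry f k n.
Proof.
case: n => // n _; elim: n => // n IH.
by rewrite last_entryS //; case: ifP.
Qed.

Lemma last_entry_mono f k m n : m <= n -> last_entry f k m <= last_entry f k n.
Proof.
move=> /subnK <-; elim: (n - m) => // d IH; rewrite addSn /=.
by case: ifP => // _; rewrite (leq_trans (last_entry_le _ _ _)) // ltnW // ltnS leq_addl.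
Qed.

Lemma last_entry_const f k m n : last_entry f k n <= m <= n ->
  last_entry f k m = last_entry f k n.
Proof.
case/andP => h1 /subnK e; rewrite -e in h1 *; elim: (n - m) h1 => // d IH.
rewrite addSn /=; case: ifP => [_|_ /IH//]; lia.
Qed.

Lemma last_entry_match f k n i : last_entry f k n <= i < n ->
  f (k + i) = f (i - last_entry f k n).
Proof.
case/andP => h1 h2.
have hq := @last_entry_const f k i.+1 n _; rewrite -hq; last lia.
have n0 : 0 < last_entry f k n by rewrite last_entry_gt0 //; lia.
have i0 : 0 < i by lia.
have := hq; rewrite last_entryS //; case: ifP => [_ e|/eqP -> -> //]; last lia.
by have := e; lia.
Qed.

Lemma last_entry_id f k n : last_entry f k (last_entry f k n) = last_entry f k n.
Proof. by apply: last_entry_const; rewrite leqnn last_entry_le. Qed.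

Lemma eq_last_entry f f' k k' n :
  (forall i, i < n -> f (k + i) = f' (k' + i)) -> (forall i, i < n -> f i = f' i) ->
  last_entry f k n = last_entry f' k' n.
Proof.
elim: n => //= n IH h1 h2.
rewrite IH; [|by move=> i hi; apply: h1; lia|by move=> i hi; apply: h2; lia].
have := last_entry_gt0 f' k' (n := n); rewrite h1 //.
by case: (posnP n) => [->//|n0 /(_ isT) q0]; rewrite h2 //; lia.
Qed.

(** From the common entry on, both addresses compare the same pairs of symbols, so they run in
    parallel. *)
Lemma last_entry_shift f k n m : 0 < n -> last_entry f k n = n ->
  last_entry f 0 (k + n) = k + n ->
  last_entry f 0 (k + n + m) = k + last_entry f k (n + m).
Proof.
move=> n0 h1 h2; elim: m => [|m IH]; first by rewrite !addn0 h1.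
rewrite !addnS !last_entryS ?add0n; [|lia|lia].
rewrite IH.
have -> : k + n + m - (k + last_entry f k (n + m)) = n + m - last_entry f k (n + m) by lia.
by rewrite addnA; case: ifP; lia.
Qed.

(* The binary number whose digits tell which of 1, ..., n are entries; comparing
   it amounts to comparing the entries lexicographically. *)
Fixpoint address_code f k n : nat :=
  if n is m.+1 then (address_code f k m).*2 + (last_entry f k n == n) else 0.

Lemma address_codeS f k n : address_code f k n.+1 =
  (address_code f k n).*2 + (last_entry f k n.+1 == n.+1).
Proof. by []. Qed.

(** Before place [d] the addresses agree. At [d] the shift by [k] has the predicted symbol, so the
    shift by [i] does not and gets an entry there; this digit outweighs all later ones. *)
Lemma address_code_lt f i k d n : 0 < d <= n ->
  (forall j, j < d.-1 -> f (i + j) = f (k + j)) -> f (i + d.-1) != f (k + d.-1) ->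
  last_entry f k d != d ->
  address_code f k n < address_code f i n.
Proof.
case: d => // d; rewrite -[d.+1.-1]/d => /andP[_ /subnK <-] heq hne hk.
have eqq j : j <= d -> last_entry f i j = last_entry f k j.
  move=> hj; apply: eq_last_entry => // l hl; apply: heq; lia.
have eqc j : j <= d -> address_code f i j = address_code f k j.
  by elim: j => // j IH hj; rewrite !address_codeS IH ?eqq // ltnW.
elim: (n - d.+1) => [|m IH]; last by rewrite addSn !address_codeS; case: (_ == _); case: (_ == _); lia.
case: (posnP d) hk => [->//|d0].
rewrite last_entryS // => hk.
have e1 : f (k + d) = f (d - last_entry f k d).
  by move: hk; case: (eqVneq (f (k + d)) _) => // _; rewrite eqxx.
have e2 : last_entry f i d.+1 = d.+1.
  by rewrite last_entryS // eqq // -e1 hne.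
have e3 : last_entry f k d.+1 == d.+1 = false.
  by rewrite last_entryS // -e1 eqxx /=; apply/eqP; have := last_entry_le f k d; lia.
by rewrite add0n !address_codeS e2 e3 eqxx eqc //; lia.
Qed.

Lemma next_entry f n M : n < M -> last_entry f 0 M = M ->
  exists2 d, 0 < d <= M - n & last_entry f 0 (n + d) = n + d /\
    forall j, 0 < j < d -> last_entry f 0 (n + j) = last_entry f 0 n.
Proof.
move=> nM hM.
have ex : exists d, (0 < d) && (last_entry f 0 (n + d) == n + d).
  by exists (M - n); rewrite subnKC ?hM ?eqxx; lia.
case: (ex_minnP ex) => d /andP[d0 /eqP hd] dmin; exists d.
  by rewrite d0 /=; apply: dmin; rewrite subnKC ?hM ?eqxx; lia.
split=> // j /andP[j0 jd]; symmetry; apply: last_entry_const; apply/andP; split; last lia.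
rewrite leqNgt; apply/negP => hlt.
have hle := last_entry_le f 0 (n + j).
have := dmin (last_entry f 0 (n + j) - n).
rewrite subnKC ?last_entry_id ?eqxx; lia.
Qed.

(* In the second case the witness is [n - p], where [p] is the last entry up to
   [n]: its shift first differs from the [n]-th one at the place [d] such that
   [n + d] is the next entry. *)
Lemma address_code_increase f n M : 0 < n < M -> last_entry f 0 M = M ->
  (forall i, f (i + M) = f i) ->
  n + last_entry f n M = M \/ exists i, address_code f n M < address_code f i M.
Proof.
case/andP=> n0 nM hM fM.
have lastM j : last_entry f 0 (M + j) = M.
  elim: j => [|j IH]; first by rewrite addn0.
  rewrite addnS last_entryS ?IH; last lia.
  by rewrite add0n addnC fM addnK eqxx.
have [d /andP[d0 dM] [hd dmin]] := next_entry nM hM.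
case: (eqVneq (last_entry f n d) d) => [hnd|hnd]; [left|right].
  (* The two addresses run in parallel after time [n + d]; at time [n + M] that of [f] still has
     last entry [M]. *)
  have -> : M = d + (M - d) by lia.
  rewrite -(last_entry_shift (M - d) d0 hnd hd).
  have -> : n + d + (M - d) = M + n by lia.
  by rewrite lastM; lia.
set p := last_entry f 0 n.
have p0 : 0 < p by apply: last_entry_gt0.
have pn : p <= n by apply: last_entry_le.
have hp : last_entry f 0 (n + d.-1) = p.
  by case: (posnP d.-1) => [->|?]; [rewrite addn0|apply: dmin; lia].
exists (n - p); apply: (address_code_lt (d := d)) => //; first lia.
- move=> j hj; have := @last_entry_match f 0 (n + d.-1) (n + j).
  rewrite hp add0n => ->; last lia.
  by congr f; lia.
- move: hd; have -> : n + d = (n + d.-1).+1 by lia.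
  rewrite last_entryS ?hp ?add0n; last lia.
  have -> : n + d.-1 - p = n - p + d.-1 by lia.
  by rewrite eq_sym; case: ifP => // _; lia.
Qed.

(* Otherwise, by [address_code_increase], every shift [k < g] has an address
   smaller than that of some other shift. *)
Lemma entry_not_multiple f g M : 0 < g -> g.*2 <= M ->
  (forall i, f (i + g) = f i) -> (forall i, f (i + M) = f i) ->
  last_entry f 0 M != M.
Proof.
move=> g0 gM fg fM; apply/eqP => hM.
have fgm i m : f (i + m * g) = f i.
  by elim: m => [|m IH]; rewrite ?addn0 // mulSn addnCA addnC fg.
have lg k n : last_entry f (k + g) n = last_entry f k n.
  by apply: eq_last_entry => // i _; rewrite addnAC fg.
have cg k n : address_code f (k + g) n = address_code f k n.
  by elim: n => // n IH; rewrite !address_codeS IH lg.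
have cm k n : address_code f k n = address_code f (k %% g) n.
  rewrite {1}(divn_eq k g) addnC; elim: (k %/ g) => [|m IH]; first by rewrite addn0.
  by rewrite mulSn addnCA addnC cg.
have inc k : k < g -> exists i, address_code f k M < address_code f i M.
  move=> kg.
  (* The shifts by [k] and [k + g] have the same address, so the first alternative cannot hold for
     both; [g.*2 <= M] ensures [k + g < M]. For [k = 0], [hM] is used instead. *)
  have [] := @address_code_increase f (k + g) M _ hM fM; [lia| |by rewrite cg].
  rewrite lg => e1; case: (posnP k) => [k0|k0]; first by move: e1; rewrite k0 hM; lia.
  by have [|e2|//] := @address_code_increase f k M _ hM fM; lia.
pose F (k : 'I_g) := address_code f k M.
have [k0] : exists k0 : 'I_g, forall i, F i <= F k0.
  have o : 'I_g by exact: Ordinal g0.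
  exists [arg max_(i > o) F i]; case: arg_maxnP => // i _ h j; exact: h.
move=> hmax; have [i] := inc k0 (ltn_ord k0).
have ig : i %% g < g by rewrite ltn_mod.
by rewrite cm (cm i) => hlt; have := hmax (Ordinal ig); rewrite /F /= (modn_small (ltn_ord k0)) in hlt *; lia.
Qed.

End Address.

(** * Renormalizable kneading sequences *)

Section Renormalization.
Local Open Scope nat_scope.
Implicit Types (nu : nat -> symbol) (M n : nat).

Lemma rhoP nu S S' : rho nu S = Some S' ->
  [/\ S < S', entry nu S' != entry nu (S' - S) &
      forall k, S < k < S' -> entry nu k = entry nu (k - S)].
Proof.
rewrite /rho; case: pselect => // ex [<-].
case: ex_minnP => k /andP[h1 h2] kmin; split=> // l /andP[l1 l2].
by apply/eqP; apply: contraTT l2 => h; rewrite -leqNgt kmin // l1.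
Qed.

Lemma rho_eq nu S S' : S < S' -> entry nu S' != entry nu (S' - S) ->
  (forall k, S < k < S' -> entry nu k = entry nu (k - S)) -> rho nu S = Some S'.
Proof.
move=> h1 h2 h3; rewrite /rho; case: pselect => [ex|[]]; last by exists S'; rewrite h1.
congr Some; case: ex_minnP => k /andP[k1 k2] kmin; apply/eqP.
rewrite eqn_leq kmin ?h1 //= leqNgt; apply/negP => h.
by move: k2; rewrite h3 ?eqxx // k1.
Qed.

(** While [S] is the last entry, [last_entry] makes the same comparisons as [rho nu S]. With
    [last_entry_internal_address], the positive fixed points of [last_entry nu 0] are the entries of
    the internal address. *)
Lemma internal_address_entry nu j S : internal_address nu j = Some S ->
  0 < S /\ last_entry nu 0 S = S.
Proof.
elim: j S => [S [<-]//|j IH S'].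
rewrite /internal_address iterS -/(internal_address nu j).
case e: (internal_address nu j) => [S|//] /= /rhoP[h1 h2 h3].
have [S0 hS] := IH _ e; split; first lia.
have hc m : S + m < S' -> last_entry nu 0 (S + m) = S.
  elim: m => [|m IHm] h; first by rewrite addn0.
  rewrite addnS last_entryS; last lia.
  rewrite IHm; last lia.
  have := h3 (S + m).+1; rewrite /entry => ->; last lia.
  by rewrite subSn ?leq_addr //= eqxx.
case: S' h1 h2 hc {h3} => // V SV h2 hc.
have hV : last_entry nu 0 V = S by rewrite -(subnKC (ltnSE SV)) hc //; lia.
by rewrite last_entryS ?hV ?add0n; [move: h2; rewrite /entry subSn // => ->|lia].
Qed.

Lemma last_entry_internal_address nu n : 0 < n ->
  exists j, internal_address nu j = Some (last_entry nu 0 n).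
Proof.
case: n => // n _; elim: n => [|n [j IH]]; first by exists 0.
rewrite last_entryS // add0n; case: ifP => h; last by exists j.
exists j.+1; rewrite /internal_address iterS -/(internal_address nu j) IH [LHS]/(rho nu _).
have hle := last_entry_le nu 0 n.+1.
have hm := @last_entry_match _ nu 0 n.+1.
move: (last_entry nu 0 n.+1) h hle hm => q h hle hm.
apply: rho_eq; rewrite /entry /=; first lia.
  by rewrite subSn.
move=> k /andP[k1 k2].
have := hm k.-1; rewrite add0n => ->; last lia.
by congr nu; lia.
Qed.

Lemma internal_address_lt nu j k S S' : j < k ->
  internal_address nu j = Some S -> internal_address nu k = Some S' -> S < S'.
Proof.
move=> /subnKC <- hS; elim: (k - j.+1) S' => [|d IH] S'.
  by rewrite addn0 /internal_address iterS -/(internal_address nu j) hS /= => /rhoP[].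
rewrite addnS /internal_address iterS -/(internal_address nu _).
case e: (internal_address nu _) => [V|//] /= /rhoP[h _ _].
exact: ltn_trans (IH _ e) h.
Qed.

Lemma renormalizable_entries M nu : simple_renormalizable M nu ->
  [/\ 0 < M, last_entry nu 0 M = M &
      forall n, M <= n -> M %| last_entry nu 0 n].
Proof.
case=> k [hk hd]; have [M0 hM] := internal_address_entry hk; split=> // n Mn.
have [|j hj] := @last_entry_internal_address nu n; first lia.
case: (leqP k j) => [kj|jk]; first exact: hd hj.
have := internal_address_lt jk hj hk.
by have := last_entry_mono nu 0 Mn; rewrite hM; lia.
Qed.

(** Beyond the first [M] places, [m.+1] is not an entry, so its symbol copies the one [S] places
    earlier, where the last entry [S] is a multiple of [M]. *)
Lemma renormalizable_mod M nu m : simple_renormalizable M nu ->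
  ~~ (M %| m.+1) -> nu m = nu (m %% M).
Proof.
case/renormalizable_entries => M0 hM hd; elim/ltn_ind: m => m IH hm.
case: (ltnP m M) => [/modn_small->//|Mm].
have := hd m.+1; rewrite last_entryS; last lia.
rewrite add0n; case: ifP => [_|/eqP -> _]; first by rewrite (negbTE hm); lia.
have := hd m Mm; have := last_entry_le nu 0 m.
have : 0 < last_entry nu 0 m by apply: last_entry_gt0; lia.
move: (last_entry nu 0 m) => S S0 Sm dS.
rewrite IH; last 2 first.
- lia.
- by apply: contra hm => h; rewrite -(subnK Sm) -addSn dvdn_add.
by congr nu; rewrite -[in RHS](subnK Sm) -modnDmr (eqP dS) addn0.
Qed.

(* The symbol at the only place where [k] carries no information is recovered by
   following the orbit of the shift by [k] modulo [M]. *)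
Lemma shift_invariant_mod M k (f : nat -> symbol) : 0 < M ->
  (forall i, f (i + M) = f i) ->
  (forall i, ~~ (M %| (i + k).+1) -> f (i + k) = f i) ->
  forall i, f (i + k) = f i.
Proof.
move=> M0 fM hf i.
have fMm j l : f (j + l * M) = f j.
  by elim: l => [|l IH]; rewrite ?addn0 // mulSn addnCA addnC fM.
have fmod j : f j = f (j %% M) by rewrite {1}(divn_eq j M) addnC fMm.
case: (boolP (M %| (i + k).+1)) => [hi|/hf//].
have last j : M %| j.+1 -> f j = f M.-1.
  move=> hj; rewrite fmod; congr f.
  have : (j %% M).+1 = 0 %[mod M] by rewrite -addn1 modnDml addn1 (eqP hj) mod0n.
  rewrite mod0n => /eqP/dvdnP[q hq].
  have := ltn_pmod j M0; case: q hq => [|[|q]] hq; rewrite ?mulSn in hq; lia.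
have chain j : f (M.-1 + j * k) = f M.-1.
  elim: j => [|j IH]; first by rewrite addn0.
  rewrite mulSn addnCA addnC.
  by case: (boolP (M %| (M.-1 + j * k + k).+1)) => [/last//|/hf ->].
(* Modulo [M], both [i] and [M.-1 * k.+1] are [- k.+1], so [i] lies on the chain of steps [k]
   starting at [M.-1]. *)
rewrite last // -(chain M.-1).
have -> : M.-1 + M.-1 * k = M.-1 * k.+1 by rewrite mulnS.
rewrite fmod [in RHS]fmod; congr f; apply/eqP; rewrite -(eqn_modDr k.+1).
by rewrite (addnS i) (eqP hi) -mulSnr prednK // modnMr.
Qed.

(** The periodic repetition of the first [M] symbols would be invariant under [r = k %% M] and
    [M - r]. One of these is at most half of [M], against [entry_not_multiple]. *)
Lemma renormalizable_not_recurrent M nu k : simple_renormalizable M nu ->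
  ~~ (M %| k) -> ~ (forall i, i < M -> nu (k + i) = nu i).
Proof.
move=> hr hk hrec; have [M0 hM _] := renormalizable_entries hr.
pose f i := nu (i %% M).
have fM i : f (i + M) = f i by rewrite /f modnDr.
have fk : forall i, f (i + k) = f i.
  apply: (shift_invariant_mod M0 fM) => i hi.
  rewrite {2}/f -hrec ?ltn_mod // /f -modnDml addnC (@renormalizable_mod M nu (k + _)) //.
  by rewrite /dvdn -addSn modnDmr addSn addnC.
set r := k %% M.
have r0 : 0 < r by rewrite lt0n.
have rM : r < M by rewrite ltn_mod.
have fr i : f (i + r) = f i by rewrite -[in RHS]fk /f modnDmr.
have frM i : f (i + (M - r)) = f i by rewrite -[LHS]fr -addnA subnK ?fM // ltnW.
have hq : last_entry f 0 M = M.
  by rewrite -[RHS]hM; apply: eq_last_entry => i iM; rewrite ?add0n /f modn_small.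
case: (leqP r.*2 M) => h.
  by have := entry_not_multiple r0 h fr fM; rewrite hq eqxx.
have := @entry_not_multiple _ f (M - r) M _ _ frM fM; rewrite hq eqxx => /(_ _ _) H.
suff : false by []. apply: H; lia.
Qed.

End Renormalization.

(** * Null sets of Hausdorff measures *)

Section HausdorffNull.
Context {R : realType} {T : metricType R}.
Implicit Types (A U : set T) (s delta : R).
Local Open Scope ereal_scope.

Lemma diam_pow_ge0 s U : 0 <= diam_pow s U.
Proof. by rewrite /diam_pow; case: ifP => // _; exact: poweR_ge0. Qed.

Lemma diam_pow0 s : diam_pow s (set0 : set T) = 0.
Proof. by rewrite /diam_pow eqxx. Qed.

Lemma diam_le U delta : (forall x y, U x -> U y -> (mdist x y <= delta)%R) ->
  diam U <= delta%:E.
Proof. by move=> h; apply: ge_ereal_sup => _ [x Ux [y Uy <-]]; rewrite lee_fin h. Qed.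

Lemma diam_pow_le s U delta : (0 <= s)%R -> (0 <= delta)%R ->
  (forall x y, U x -> U y -> (mdist x y <= delta)%R) ->
  diam_pow s U <= (delta `^ s)%:E.
Proof.
move=> s0 d0 h; rewrite /diam_pow; case: (eqVneq U set0) => [_|/set0P[x Ux]].
  by rewrite lee_fin powR_ge0.
have hd : 0 <= diam U.
  by apply: ereal_sup_ubound; exists x => //; exists x => //; rewrite mdistxx.
rewrite -poweR_EFin; apply: gt0_ler_poweR => //; last exact: diam_le.
- by rewrite in_itv /= hd leey.
- by rewrite in_itv /= lee_fin d0 leey.
Qed.

Lemma hausdorff_premeasure_ge0 s delta A : 0 <= hausdorff_premeasure s delta A.
Proof.
by apply: le_ereal_inf_tmp => _ [U _ <-]; apply: nneseries_ge0 => *; exact: diam_pow_ge0.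
Qed.

Lemma hausdorff_measure_eq0P s A : hausdorff_measure s A = 0 <->
  forall delta e : R, (0 < delta)%R -> (0 < e)%R -> exists U : nat -> set T,
    [/\ A `<=` \bigcup_i U i, forall i, diam (U i) <= delta%:E &
        \sum_(i <oo) diam_pow s (U i) <= e%:E].
Proof.
split=> [h delta e d0 e0|h].
  have hp : hausdorff_premeasure s delta A = 0.
    apply/eqP; rewrite eq_le hausdorff_premeasure_ge0 andbT -h.
    by apply: ereal_sup_ubound; exists delta.
  have /(lb_ereal_inf_adherent e0) : hausdorff_premeasure s delta A \is a fin_num.
    by rewrite hp.
  move=> [_ [U [AU dU] <-]]; rewrite -/(hausdorff_premeasure s delta A) hp add0e => hlt.
  by exists U; split => //; exact: ltW.
apply/eqP; rewrite eq_le; apply/andP; split.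
  apply: ge_ereal_sup => _ [delta d0 <-]; apply/lee_addgt0Pr => e e0; rewrite add0e.
  have [U [AU dU hU]] := h _ _ d0 e0.
  by apply: le_trans hU; apply: ereal_inf_lbound; exists U.
apply: le_trans (hausdorff_premeasure_ge0 s 1 A) _.
by apply: ereal_sup_ubound; exists 1%R => //=; rewrite ltr01.
Qed.

Lemma hausdorff_measure0_subset s A B : A `<=` B ->
  hausdorff_measure s B = 0 -> hausdorff_measure s A = 0.
Proof.
move=> AB /hausdorff_measure_eq0P h; apply/hausdorff_measure_eq0P => d e d0 e0.
by have [U [BU dU hU]] := h d e d0 e0; exists U; split => //; exact: subset_trans BU.
Qed.

Lemma hausdorff_measure0_bigcup s (F : nat -> set T) :
  (forall n, hausdorff_measure s (F n) = 0) ->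
  hausdorff_measure s (\bigcup_n F n) = 0.
Proof.
move=> h; apply/hausdorff_measure_eq0P => d e d0 e0.
have /choice[U hU] : forall n, exists U : nat -> set T,
    [/\ F n `<=` \bigcup_i U i, forall i, diam (U i) <= d%:E &
        \sum_(i <oo) diam_pow s (U i) <= (e / (2 ^ n.+1)%:R)%:E].
  move=> n; apply: (hausdorff_measure_eq0P s (F n)).1 => //.
  by rewrite divr_gt0 // ltr0n expn_gt0.
have /card_esym/ppcard_eqP[f] := card_nat2.
exists (uncurry U \o f); split.
- move=> x [n _ Fx]; have [/(_ _ Fx)[i _ Ux] _ _] := hU n.
  by exists (f^-1%FUN (n, i)) => //=; rewrite invK ?inE.
- move=> i; rewrite /comp; case: (f i) => n j.
  by have [_ hd _] := hU n; exact: hd.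
rewrite nneseries_esumT; last by move=> n; exact: diam_pow_ge0.
have -> : \esum_(i in [set: nat]) diam_pow s ((uncurry U \o f) i) =
    \esum_(k in [set: nat] `*`` (fun=> [set: nat])) diam_pow s (U k.1 k.2).
  have -> : [set: nat] `*`` (fun=> [set: nat]) = [set: nat * nat].
    by apply/seteqP; split.
  rewrite (@reindex_esum _ _ _ [set: nat] _ f) //.
  by apply: eq_esum => i _ /=; case: (f i).
rewrite -(@esum_esum _ _ _ [set: nat] (fun=> [set: nat]) (fun i j => diam_pow s (U i j)));
  last by move=> *; exact: diam_pow_ge0.
rewrite -nneseries_esumT; last by move=> n; apply: esum_ge0 => *; exact: diam_pow_ge0.
apply: le_trans (epsilon_trick0 xpredT (ltW e0)).
apply: lee_nneseries => n _; first by move=> _; apply: esum_ge0 => *; exact: diam_pow_ge0.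
by rewrite -nneseries_esumT => [|*]; [case: (hU n)|exact: diam_pow_ge0].
Qed.

Lemma hausdorff_measure0_bigcup_countable (I : countType) s (F : I -> set T) :
  (forall i, hausdorff_measure s (F i) = 0) ->
  hausdorff_measure s (\bigcup_i F i) = 0.
Proof.
move=> h; pose G n := if unpickle n is Some i then F i else set0.
apply: (@hausdorff_measure0_subset _ _ (\bigcup_n G n)).
  by move=> x [i _ Fx]; exists (pickle i) => //; rewrite /G pickleK.
apply: hausdorff_measure0_bigcup => n; rewrite /G; case: unpickle => // .
apply/hausdorff_measure_eq0P => d e d0 e0; exists (fun=> set0); split => //.
- by move=> _; apply: diam_le.
- by rewrite eseries0 ?lee_fin ?ltW // => *; rewrite diam_pow0.
Qed.

Lemma hausdorff_measure0U s A B : hausdorff_measure s A = 0 ->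
  hausdorff_measure s B = 0 -> hausdorff_measure s (A `|` B) = 0.
Proof.
move=> hA hB; rewrite -bigcup2E; apply: hausdorff_measure0_bigcup => -[|[|n]] //=.
by apply: hausdorff_measure0_subset hA.
Qed.

Lemma hausdorff_dim_le s0 A : (0 <= s0)%R ->
  (forall s, (s0 < s)%R -> hausdorff_measure s A = 0) -> hausdorff_dim A <= s0%:E.
Proof.
move=> h0 h; apply/lee_addgt0Pr => e e0; apply: ereal_inf_lbound.
exists (s0 + e)%R => //; split; first by rewrite addr_ge0 // ltW.
by apply: h; rewrite ltrDl.
Qed.

Lemma hausdorff_dim_ge0 A : 0 <= hausdorff_dim A.
Proof. by apply: le_ereal_inf_tmp => _ [s [s0 _] <-]; rewrite lee_fin. Qed.

(** The value [l = 0] is allowed, so that single points can be covered by themselves. *)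
Lemma hausdorff_measure0_finite_covers s A : (0 <= s)%R ->
  (forall delta e : R, (0 < delta)%R -> (0 < e)%R -> exists l : R, exists L : seq (set T),
    [/\ (0 <= l <= delta)%R, ((size L)%:R * (l `^ s) <= e)%R,
        forall U, U \in L -> forall x y, U x -> U y -> (mdist x y <= l)%R &
        forall x, A x -> exists2 U, U \in L & U x]) ->
  hausdorff_measure s A = 0.
Proof.
move=> s0 h; apply/hausdorff_measure_eq0P => d e d0 e0.
have [l [L [/andP[l0 ld] hs hL hA]]] := h d e d0 e0.
have hd i x y : nth set0 L i x -> nth set0 L i y -> (mdist x y <= l)%R.
  case: (ltnP i (size L)) => hi; last by rewrite nth_default.
  by apply: hL; exact: mem_nth.
exists (nth set0 L); split.
- move=> x /hA[U UL Ux]; exists (index U L) => //.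
  by rewrite nth_index.
- by move=> i; apply: diam_le => x y /hd h' /h' h''; exact: le_trans ld.
rewrite (nneseries_split 0 (size L)); last by move=> *; exact: diam_pow_ge0.
rewrite eseries0 => [|i hi _]; last by rewrite nth_default // diam_pow0.
rewrite adde0 add0n.
apply: (@le_trans _ _ (\sum_(0 <= i < size L) (l `^ s)%:E)).
  by apply: lee_sum => i _; apply: diam_pow_le => //; exact: hd.
by rewrite sumEFin lee_fin big_const_nat iter_addr addr0 subn0 -mulr_natl.
Qed.

End HausdorffNull.

(** * Covers of sets of binary expansions *)

Section Coding.
Context {R : realType}.
Implicit Types (t x y : R) (a : seq bool) (M m n : nat).

Lemma circle_dist_to_circle x y :
  circle_dist (to_circle x) (to_circle y) <= `|x - y|.
Proof.
rewrite /circle_dist /=.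
have /andP[x0 x1] := frac_part_itv x; have /andP[y0 y1] := frac_part_itv y.
have : x - y = frac_part x - frac_part y + (Num.floor x - Num.floor y)%:~R.
  by rewrite /frac_part rmorphB /=; ring.
move: (frac_part x) (frac_part y) (Num.floor x - Num.floor y) x0 x1 y0 y1.
move=> u v k u0 u1 v0 v1 ->; rewrite ge_min.
case: (ltrgtP k 0) => [k0|k0|->]; last by rewrite addr0 lexx.
- have k1 : k%:~R <= -1 :> R.
    by rewrite -[-1](mulrN1z 1) ler_int -ltzD1 addNr.
  apply/orP; right; rewrite [X in _ <= X]ltr0_norm; last lra.
  by case: (lerP v u) => ?; lra.
- have k1 : 1 <= k%:~R :> R by rewrite -[1](mulr1z 1) ler_int -gtz0_ge1.
  apply/orP; right; rewrite [X in _ <= X]gtr0_norm; last lra.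
  by case: (lerP v u) => ?; lra.
Qed.

(* [b] is the binary expansion of [y 0]; at the places not divisible by [M] it
   is determined by the word [a] and the position of the tail relative to [t]. *)
Definition coded_by M t a (y : nat -> R) (b : nat -> bool) : Prop :=
  [/\ forall n, 0 <= y n <= 1, forall n, y n = ((b n)%:R + y n.+1) / 2 &
      forall n, ~~ (M %| n.+1)%N -> b n = nth false a (n %% M) (+) (t < y n.+1)].

Definition coded_points M t a : set (circle R) :=
  [set to_circle (y 0%N) | y in [set y | exists b, coded_by M t a y b]].

(** Centers of intervals of radius [2^-n] capturing all possible [y m]. At a constrained place, the
    preimages of [t] under doubling make up for centers on the wrong side of [t]. *)
Fixpoint centers M t a m n : seq R :=
  if n is n'.+1 then
    let L := centers M t a m.+1 n' in
    if (M %| m.+1)%N then [seq p / 2 | p <- L] ++ [seq (1 + p) / 2 | p <- L]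
    else [:: t / 2, (1 + t) / 2 &
             [seq ((nth false a (m %% M) (+) (t < p))%:R + p) / 2 | p <- L]]
  else [:: 2^-1].

Lemma centersP M t a (y : nat -> R) b m n : coded_by M t a y b ->
  exists2 p, p \in centers M t a m n & `|y m - p| <= 2^-1 ^+ n.
Proof.
case=> y01 yb ba; elim: n m => [|n IH] m.
  exists 2^-1; first by rewrite inE.
  by have /andP[h0 h1] := y01 m; rewrite expr0 ler_norml; lra.
have [p pL hp] := IH m.+1.
have half q : `|y m.+1 - q| <= 2^-1 ^+ n ->
    `|y m - ((b m)%:R + q) / 2| <= 2^-1 ^+ n.+1.
  move=> hq; have -> : y m - ((b m)%:R + q) / 2 = (y m.+1 - q) / 2 by rewrite yb; lra.
  by rewrite normrM (ger0_norm (_ : 0 <= 2^-1)) // exprSr ler_pM2r.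
rewrite /=; case: ifPn => hM.
  exists (((b m)%:R + p) / 2); last exact: half.
  rewrite mem_cat; case: (b m); apply/orP; [right|left]; apply/mapP; exists p => //.
  by rewrite add0r.
have hb := ba _ hM.
case: (eqVneq (t < y m.+1) (t < p)) => [e|ne].
  exists (((b m)%:R + p) / 2); last exact: half.
  by rewrite !inE hb e; apply/orP; right; apply/orP; right; apply/mapP; exists p.
(* Here [t] lies between [p] and [y m.+1], so it is at least as close to [y m.+1] as [p] is. *)
exists (((b m)%:R + t) / 2).
  by rewrite !inE; case: (b m); rewrite ?add0r eqxx ?orbT.
apply: half; apply: le_trans hp; move: ne.
by case: (ltP t (y m.+1)); case: (ltP t p) => //= h1 h2 _; rewrite !ler_norml;
  case: (lerP p (y m.+1)) => ?; lra.
Qed.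

Lemma size_centers M t a N m : (0 < M)%N -> (M %| m)%N ->
  (size (centers M t a m (N * M)) <= M.*2.+1 * 2 ^ N)%N.
Proof.
move=> M0 Mm.
(* The free place ending the block doubles the centers of the remaining tail; then each of the [r]
   constrained places before it adds two. *)
have step r k n : (r < M)%N -> (M %| k + r.+1)%N ->
    (size (centers M t a k (r.+1 + n)) <=
       (size (centers M t a (k + r.+1) n)).*2 + r.*2)%N.
  elim: r k => [|r IH] k rM hk.
    by rewrite addn1 in hk *; rewrite /= hk size_cat !size_map addnn addn0.
  have hk' : (M %| k.+1 + r.+1)%N by rewrite addSnnS.
  have hn : ~~ (M %| k.+1)%N.
    apply/negP => /(dvdn_sub hk); have -> : (k + r.+2 - k.+1 = r.+1)%N by lia.
    by move=> /dvdn_leq; lia.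
  have -> : size (centers M t a k (r.+2 + n)) = (size (centers M t a k.+1 (r.+1 + n))).+2.
    by rewrite [(r.+2 + n)%N]addSn /= (negbTE hn) /= size_map.
  by have := IH k.+1 (ltnW rM) hk'; rewrite (addSnnS k); lia.
(* The added [M.*2] absorbs the additive term of the recursion. *)
suff : (size (centers M t a m (N * M)) + M.*2 <= M.*2.+1 * 2 ^ N)%N by lia.
elim: N m Mm => [|N IH] m Mm; first by rewrite mul0n /= expn0; lia.
have := step M.-1 m (N * M)%N _ _; rewrite prednK // -mulSn => /(_ _ _).
have hm : (M %| m + M)%N by rewrite dvdn_addl.
move=> /(_ (leqnn _) hm); have := IH _ hm; rewrite expnS.
move: (size _) (size _) (2 ^ N)%N => u v w; lia.
Qed.

Lemma powR_expr (x s : R) n : 0 <= x -> (x ^+ n) `^ s = (x `^ s) ^+ n.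
Proof. by move=> x0; rewrite -!powR_mulrn ?powR_ge0 // powRAC. Qed.

(** The left side is the ratio by which the bound on the [s]-sum changes with each block of [M]
    digits; it equals [(1/2)^(M s - 1)]. *)
Lemma half_powR_lt M (s : R) : (0 < M)%N -> M%:R^-1 < s ->
  2 * (2^-1 ^+ M) `^ s < 1 :> R.
Proof.
move=> M0 hs; have M0' : 0 < M%:R :> R by rewrite ltr0n.
have c0 : 0 < M%:R * s - 1.
  by rewrite subr_gt0 -(ltr_pM2l M0') mulfV ?gt_eqF // in hs *.
rewrite -powR_mulrn ?invr_ge0 // -powRrM -[M%:R * s](subrKC 1).
rewrite powRD ?powRr1 ?invr_ge0 //; last by apply/implyP => _; rewrite invr_neq0.
rewrite mulrA mulfV // mul1r.
have h : 2^-1 < 1 :> R by rewrite invf_lt1 ?ltr1n.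
by have := gt0_ltr_powR c0 _ _ h; rewrite powR1; apply; rewrite nnegrE ?invr_ge0.
Qed.

Lemma coded_points_null M t a s : (0 < M)%N -> M%:R^-1 < s ->
  hausdorff_measure s (coded_points M t a) = 0%E.
Proof.
move=> M0 hs; have s0 : 0 <= s by apply: ltW; apply: le_lt_trans hs; rewrite invr_ge0.
apply: hausdorff_measure0_finite_covers => // d e d0 e0.
set h : R := 2^-1 ^+ M; set k := 2 * h `^ s.
have k1 : `|k| < 1.
  by rewrite ger0_norm ?half_powR_lt // /k mulr_ge0 // powR_ge0.
have h0 : 0 <= h by rewrite exprn_ge0 ?invr_ge0.
have h1 : `|h| < 1.
  by rewrite ger0_norm // exprn_ilt1 // ?invr_ge0 // ?invf_lt1 ?ltr1n // -lt0n.
(* After [N] blocks there are at most [(2 M + 1) 2^N] sets of diameter at most [2 h^N], so this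
   geometric sequence bounds their [s]-sum. *)
have := cvg_geometric (M.*2.+1%:R * 2 `^ s) k1.
move=> /cvgr0Pnorm_le /(_ _ e0) ev1.
have := cvg_geometric 2 h1 => /cvgr0Pnorm_le /(_ _ d0) ev2.
have [N [/(le_trans (ler_norm _)) hN1 /(le_trans (ler_norm _)) hN2]] :=
  filter_ex (filterI ev1 ev2).
exists (2 * h ^+ N), [seq [set to_circle x | x in [set x | `|x - p| <= h ^+ N]]
                       | p <- centers M t a 0 (N * M)]; split.
- rewrite mulr_ge0 ?exprn_ge0 //=; exact: hN2.
- apply: (le_trans _ hN1); rewrite /geometric /=.
  rewrite size_map powRM ?exprn_ge0 // powR_expr // exprMn.
  rewrite mulrA [_ * (2 ^+ N * _)]mulrA ler_wpM2r ?exprn_ge0 ?powR_ge0 //.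
  rewrite mulrAC ler_wpM2r ?powR_ge0 //.
  by rewrite -natrX -natrM ler_nat size_centers.
- move=> U /mapP[p _ ->] _ _ [x hx <-] [y hy <-].
  apply: le_trans (circle_dist_to_circle x y) _.
  have -> : x - y = (x - p) - (y - p) by ring.
  apply: le_trans (ler_normB _ _) _; move: hx hy => /=; lra.
- move=> _ [y [b hy] <-].
  have [p hp hd] := centersP 0 (N * M) hy.
  exists [set to_circle x | x in [set x | `|x - p| <= h ^+ N]]; first exact: map_f.
  by exists (y 0%N) => //=; rewrite /h -exprM mulnC.
Qed.

End Coding.

(** * Sequences and angles *)

Section Sequences.
Context {R : realType}.
Implicit Types (x : nat -> bool).

Definition binary_sum x n : R := \sum_(1 <= k < n) (entry x k)%:R * 2 ^- k.

Definition tail x : nat -> bool := fun i => x i.+1.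

Lemma binary_sumS x n :
  binary_sum x n.+2 = ((x 0%N)%:R + binary_sum (tail x) n.+1) / 2.
Proof.
rewrite /binary_sum big_nat_recl // expr1 mulrDl; congr (_ + _).
rewrite mulr_suml; apply: eq_big_nat => k /andP[k0 _].
by rewrite exprSr invfM mulrA /entry /tail -[k.+1.-1]/k -{1}(prednK k0).
Qed.

Lemma binary_sum_itv x n : 0 <= binary_sum x n <= 1.
Proof.
elim: n x => [|[|n] IH] x; rewrite ?binary_sumS.
- by rewrite /binary_sum big_geq // lexx ler01.
- by rewrite /binary_sum big_geq // lexx ler01.
by have /andP[h0 h1] := IH (tail x); case: (x 0%N) => /=; apply/andP; split; lra.
Qed.

Lemma binary_sum_cvg x : cvgn (binary_sum x).
Proof.
apply: nondecreasing_is_cvgn.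
  apply/nondecreasing_seqP => -[|n]; rewrite /binary_sum; first by rewrite !big_geq.
  by rewrite [leRHS]big_nat_recr //= lerDl mulr_ge0 // invr_ge0 exprn_ge0.
by exists 1 => _ [n _ <-]; have /andP[] := binary_sum_itv x n.
Qed.

(** The threshold 2 exceeds all tail values, so the comparison in [coded_by] is always false and the
    word alone gives the constrained digits. *)
Lemma binary_angle_coded M x : (0 < M)%N ->
  (forall m, ~~ (M %| m.+1)%N -> x m = x (m %% M)%N) ->
  coded_points M (ratr 2) (mkseq x M) (binary_angle x : circle R).
Proof.
move=> M0 hx.
(* Tails stay real numbers: a tail of ones has value 1, which reduction modulo 1 would send to 0. *)
pose y n := limn (binary_sum (fun i => x (n + i)%N)).
exists y => //; exists x.
have y01 n : 0 <= y n <= 1.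
  have hc := @binary_sum_cvg (fun i => x (n + i)%N).
  apply/andP; split.
    apply: limr_ge => //; apply: nearW => k.
    by have /andP[] := binary_sum_itv (fun i => x (n + i)%N) k.
  apply: limr_le => //; apply: nearW => k.
  by have /andP[] := binary_sum_itv (fun i => x (n + i)%N) k.
split=> // [n|n hn]; last first.
  rewrite nth_mkseq ?ltn_pmod // -hx //.
  have /andP[_ h1] := y01 n.+1.
  by rewrite ratr_nat ltNge (le_trans h1) ?ler1n // addbF.
apply: cvg_lim => //.
have hc := @binary_sum_cvg (fun i => x (n.+1 + i)%N).
suff h : (fun k => binary_sum (fun i => x (n + i)%N) k.+2) @ \oo -->
    ((x n)%:R + y n.+1) / 2.
  by rewrite -cvg_shiftS -cvg_shiftS.
have -> : (fun k => binary_sum (fun i => x (n + i)%N) k.+2) =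
          (fun k => ((x n)%:R + binary_sum (fun i => x (n.+1 + i)%N) k.+1) / 2).
  apply/funext => k; rewrite binary_sumS addn0; congr ((_ + binary_sum _ _) / 2).
  by apply/funext => i; rewrite /tail addSnnS.
apply: cvgMl; apply: cvgD; first exact: cvg_cst.
by rewrite (@cvg_shiftS _ (binary_sum _)).
Qed.

End Sequences.

(** * Itineraries under doubling and the countable cover by coded sets *)

Section Angles.
Context {R : realType}.
Implicit Types (theta x : circle R) (M k n : nat).

Lemma frac_partE (u : R) (k : int) : 0 <= u + k%:~R < 1 -> frac_part u = u + k%:~R.
Proof.
move=> /andP[h0 h1]; rewrite /frac_part (@floor_def _ u (- k)) ?mulrNz ?opprK //.
by rewrite rmorphD /= rmorphN /=; apply/andP; split; lra.
Qed.

Definition bit x : bool := 2^-1 <= angle x.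

Lemma angle_doubling x : angle (doubling x) = 2 * angle x - (bit x)%:R.
Proof.
have /andP[x0 x1] := angle_itv x.
rewrite /= (@frac_partE _ (- (bit x)%:Z)) /bit ?mulrNz //.
by case: (lerP 2^-1 (angle x)) => /= h; rewrite ?mulr0z; apply/andP; split; lra.
Qed.

(** Doubling is increasing on [[0, 1/2)] and on [[1/2, 1)], and each half contains one preimage of
    [theta]; the order of [doubling x] and [theta] tells on which side of it [x] lies. *)
Lemma itinerary_symbolE theta x : angle (doubling x) != angle theta ->
  itinerary_symbol theta x = Some (bit x (+) (angle theta < angle (doubling x))).
Proof.
rewrite angle_doubling => hne.
have /andP[x0 x1] := angle_itv x; have /andP[t0 t1] := angle_itv theta.
rewrite /itinerary_symbol /in_arc /=.
rewrite (@frac_partE (angle theta / 2) 0) ?addr0; last by apply/andP; split; lra.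
rewrite (@frac_partE ((1 + angle theta) / 2) 0) ?addr0; last by apply/andP; split; lra.
rewrite (@frac_partE (angle theta / 2 - (1 + angle theta) / 2) 1); last by apply/andP; split; lra.
rewrite (@frac_partE ((1 + angle theta) / 2 - angle theta / 2) 0); last by apply/andP; split; lra.
have hb : bit x = (2^-1 <= angle x) by [].
move: hne; rewrite hb; move: (angle x) (angle theta) x0 x1 t0 t1 => u t u0 u1 t0 t1.
case: (lerP 2^-1 u) => /= hu; case: (ltrgtP t (2 * u - _)) => //= ht _.
- rewrite (@frac_partE (u - (1 + t) / 2) 0); last by apply/andP; split; lra.
  by rewrite ifT //; apply/andP; split; lra.
- rewrite (@frac_partE (u - (1 + t) / 2) 1); last by apply/andP; split; lra.
  rewrite (@frac_partE (u - t / 2) 0); last by apply/andP; split; lra.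
  by rewrite ifF ?ifT //; [apply/andP; split; lra|apply/negbTE; rewrite negb_and -!leNgt; apply/orP; right; lra].
- rewrite (@frac_partE (u - (1 + t) / 2) 1); last by apply/andP; split; lra.
  rewrite (@frac_partE (u - t / 2) 0); last by apply/andP; split; lra.
  by rewrite ifF ?ifT //; [apply/andP; split; lra|apply/negbTE; rewrite negb_and -!leNgt; apply/orP; right; lra].
- rewrite (@frac_partE (u - (1 + t) / 2) 1); last by apply/andP; split; lra.
  by rewrite ifT //; apply/andP; split; lra.
Qed.

Lemma angle_iter_doubling theta n :
  exists k : int, angle (iter n doubling theta) = 2 ^+ n * angle theta + k%:~R.
Proof.
elim: n => [|n [k IH]]; first by exists 0; rewrite mul1r addr0.
exists (2 * k - (bit (iter n doubling theta))%:Z).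
by rewrite iterS angle_doubling IH exprS rmorphB /= rmorphM /=; ring.
Qed.

(** Either coincidence is a linear equation for [angle theta] with rational coefficients, the
    leading one being [2^n] or [2^n - 1]. *)
Lemma irrational_orbit theta n : (forall q, angle theta <> ratr q) ->
  [/\ angle (iter n doubling theta) != 2^-1 &
      (0 < n)%N -> angle (iter n doubling theta) != angle theta].
Proof.
move=> irr; have [k ->] := angle_iter_doubling theta n; split.
  apply/eqP => h; apply: (irr ((2^-1 - k%:~R) / 2 ^+ n)).
  rewrite rmorphM rmorphB /= fmorphV ratr_int fmorphV rmorphXn /= !ratr_nat -h addrK.
  by rewrite mulrAC mulfV ?mul1r // expf_neq0.
move=> n0; apply/eqP => h.
have e : (2 ^+ n - 1 : R) != 0.
  by rewrite subr_eq0 gt_eqF // exprn_egt1 // ?ltr1n // -lt0n.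
apply: (irr (- k%:~R / (2 ^+ n - 1))).
rewrite rmorphM rmorphN /= fmorphV rmorphB rmorphXn /= rmorph1 ratr_int ratr_nat.
apply: (mulIf e); rewrite divfK //.
by rewrite mulrBr mulr1 mulrC -[X in _ - X]h; ring.
Qed.

Lemma kneadingE theta n : (forall q, angle theta <> ratr q) ->
  kneading theta n = Some (bit (iter n doubling theta) (+)
    (angle theta < angle (iter n.+1 doubling theta))).
Proof.
move=> irr; rewrite /kneading itinerary_symbolE //.
by have [_ ->] := @irrational_orbit theta n.+1 irr.
Qed.

(** Digits jump at 1/2 and comparisons at [theta]; the gap makes both stable along an initial piece
    of the orbit. *)
Lemma orbit_gap theta n : (forall q, angle theta <> ratr q) ->
  exists2 e : R, 0 < e & forall i, (i <= n)%N ->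
    e <= `|angle (iter i doubling theta) - 2^-1| /\
    ((0 < i)%N -> e <= `|angle (iter i doubling theta) - angle theta|).
Proof.
move=> irr; elim: n => [|n [e e0 he]].
  exists `|angle theta - 2^-1| => [|i]; last by case: i.
  by rewrite normr_gt0 subr_eq0; have [] := @irrational_orbit theta 0%N irr.
have [h1 /(_ isT) h2] := @irrational_orbit theta n.+1 irr.
exists (Num.min e (Num.min `|angle (iter n.+1 doubling theta) - 2^-1|
                           `|angle (iter n.+1 doubling theta) - angle theta|)).
  by rewrite !lt_min e0 !normr_gt0 !subr_eq0 h1 h2.
move=> i; rewrite leq_eqVlt => /orP[/eqP -> |/he[h3 h4]].
  by split => *; rewrite !ge_min lexx ?orbT.
by split => *; rewrite ge_min ?h3 ?h4.
Qed.

Lemma lt_near (z u v e : R) : `|u - v| < e -> e <= `|v - z| -> (z < u) = (z < v).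
Proof.
move=> h1 h2; apply/idP/idP => h; rewrite ltNge; apply/negP => h'; move: h1 h2;
  rewrite ltr_norml => /andP[h3 h4].
- by rewrite ler0_norm; lra.
- by rewrite ger0_norm; lra.
Qed.

(** A closer return at time [k] would repeat the first [M] symbols there, against
    [renormalizable_not_recurrent]. *)
Lemma renormalizable_gap M theta : (forall q, angle theta <> ratr q) ->
  simple_renormalizable M (kneading theta) ->
  exists2 d : R, 0 < d & forall k, ~~ (M %| k)%N ->
    d <= `|angle (iter k doubling theta) - angle theta|.
Proof.
move=> irr hr; have [e e0 he] := orbit_gap M irr.
have p2 : 0 < 2 ^+ M :> R by rewrite exprn_gt0.
exists (e / 2 ^+ M); first by rewrite divr_gt0.
move=> k hk; rewrite leNgt; apply/negP => hlt.
apply: (renormalizable_not_recurrent hr hk).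
pose x i := iter i doubling theta.
have bitE i : (i <= M)%N -> `|angle (x (k + i)%N) - angle (x i)| < e ->
    bit (x (k + i)%N) = bit (x i).
  move=> iM hi; have [h1 _] := he i iM; rewrite /bit.
  have [h2 _] := @irrational_orbit theta (k + i)%N irr.
  have [h3 _] := @irrational_orbit theta i irr.
  by rewrite !le_eqVlt ![2^-1 == _]eq_sym (negbTE h2) (negbTE h3) /= (lt_near hi h1).
have small i : (i <= M)%N -> 2 ^+ i * `|angle (x k) - angle theta| < e.
  move=> iM; apply: le_lt_trans (_ : 2 ^+ M * `|angle (x k) - angle theta| < e).
    by rewrite ler_wpM2r // ler_weXn2l // ler1n.
  by rewrite mulrC -ltr_pdivlMr.
(* Points with equal digits lie on the same affine branch, so doubling exactly doubles their
   distance. Starting below [e / 2 ^+ M], it stays below [e] for [M] steps, which keeps the digits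
   equal. *)
have dist i : (i <= M)%N ->
    `|angle (x (k + i)%N) - angle (x i)| = 2 ^+ i * `|angle (x k) - angle theta|.
  elim: i => [|i IH] iM; first by rewrite addn0 mul1r.
  have {}IH := IH (ltnW iM).
  have hb := bitE i (ltnW iM); rewrite IH in hb; have {}hb := hb (small i (ltnW iM)).
  rewrite addnS [x (k + i).+1]iterS [x i.+1]iterS !angle_doubling -/(x _) -/(x _) hb.
  rewrite exprS -mulrA -IH -[X in X * `|_|](ger0_norm (_ : 0 <= 2)) // -normrM.
  by congr `|_|; ring.
have close i : (i <= M)%N -> `|angle (x (k + i)%N) - angle (x i)| < e.
  by move=> iM; rewrite dist ?small.
move=> i iM; rewrite !kneadingE // -/(x _) -/(x _) -/(x _) -/(x _).
rewrite bitE ?close // 1?ltnW // -addnS.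
have [_ /(_ isT) h] := he i.+1 iM.
by rewrite (lt_near (close i.+1 iM) h).
Qed.

Lemma irrational_angle_coded M theta : (forall q, angle theta <> ratr q) ->
  simple_renormalizable M (kneading theta) ->
  exists q a, coded_points M (ratr q) a theta.
Proof.
move=> irr hr; have [M0 _ _] := renormalizable_entries hr.
have [d d0 hd] := renormalizable_gap irr hr.
(* At times not divisible by [M] the orbit keeps distance at least [d] from [theta], so a rational
   in this interval gives the same comparisons as [theta]. *)
have [|q] := @rat_in_itvoo _ (angle theta) (angle theta + d); first by rewrite ltrDl.
rewrite in_itv /= => /andP[q1 q2].
pose x i := iter i doubling theta.
exists q, (mkseq (fun i => kneading theta i == Some true) M), (fun n => angle (x n)).
  exists (fun n => bit (x n)); split=> [n|n|n hn].
  - by have /andP[h0 h1] := angle_itv (x n); rewrite h0 ltW.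
  - by rewrite [x n.+1]iterS angle_doubling -/(x n) addrC subrK mulrC mulKf.
  have -> : (ratr q < angle (x n.+1)) = (angle theta < angle (x n.+1)).
    have := hd _ hn; rewrite -/(x _).
    case: (ltP (angle theta) (angle (x n.+1))) => h.
      by rewrite gtr0_norm ?subr_gt0 // => h'; apply/idP; lra.
    by move=> _; apply/negbTE; rewrite -leNgt; lra.
  rewrite nth_mkseq ?ltn_pmod // -(renormalizable_mod hr hn) kneadingE // -/(x _) -/(x _).
  by case: (bit _); case: (_ < _).
apply: val_inj; rewrite /= (@frac_partE _ 0) addr0 //; exact: angle_itv.
Qed.

(* The rational angles include the (pre)periodic ones, whose kneading sequence
   may contain a star or whose orbit may meet the partition. *)
Definition coded_cover M : set (circle R) :=
  \bigcup_(q : rat) [set to_circle (ratr q)] `|`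
  \bigcup_(p : rat * seq bool) coded_points M (ratr p.1) p.2.

Lemma coded_cover_null M s : (0 < M)%N -> M%:R^-1 < s ->
  hausdorff_measure s (coded_cover M) = 0%E.
Proof.
move=> M0 hs; have s0 : 0 < s by apply: le_lt_trans hs; rewrite invr_ge0.
apply: hausdorff_measure0U; apply: hausdorff_measure0_bigcup_countable => i; last first.
  exact: coded_points_null.
apply: hausdorff_measure0_finite_covers; first exact: ltW.
move=> d e d0 e0; exists 0, [:: [set to_circle (ratr i)]]; split.
- by rewrite lexx ltW.
- by rewrite powR0 ?gt_eqF // mulr0 ltW.
- by move=> U; rewrite inE => /eqP -> x y -> ->; rewrite mdistxx.
- by move=> x ->; exists [set to_circle (ratr i)] => //; rewrite inE.
Qed.

Lemma renormalizable_angle_coded M theta :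
  simple_renormalizable M (kneading theta) -> coded_cover M theta.
Proof.
move=> hr; case: (pselect (exists q, angle theta = ratr q)) => [[q hq]|irr].
  left; exists q => //=; apply: val_inj; rewrite /= (@frac_partE _ 0) addr0 -hq //.
  exact: angle_itv.
have [q [a h]] : exists q a, coded_points M (ratr q) a theta.
  by apply: irrational_angle_coded hr => q hq; apply: irr; exists q.
by right; exists (q, a).
Qed.

Lemma renormalizable_sequence_coded M (x : nat -> bool) :
  simple_renormalizable M (fun i => Some (x i)) -> coded_cover M (binary_angle x).
Proof.
move=> hr; have [M0 _ _] := renormalizable_entries hr.
right; exists (2%:R, mkseq x M) => //; apply: binary_angle_coded => // m hm.
by have [] := renormalizable_mod hr hm.
Qed.

(** For [s > 0] and [N > 1/s], all covers of period at least [N] are [s]-null, and so is their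
    countable union. *)
Lemma infinite_cover_dim (A : set (circle R)) :
  (forall N, A `<=` \bigcup_n coded_cover (n + N)) -> hausdorff_dim A = 0%E.
Proof.
move=> hA; apply/eqP; rewrite eq_le hausdorff_dim_ge0 andbT.
apply: hausdorff_dim_le => // s s0.
pose N := (Num.truncn s^-1).+1.
have hN n : (n + N)%:R^-1 < s.
  rewrite invf_plt ?posrE ?ltr0n ?addnS //.
  apply: lt_le_trans (truncnS_gt _) _; rewrite ler_nat; exact: leq_addl.
apply: (hausdorff_measure0_subset (hA N)); apply: hausdorff_measure0_bigcup => n.
by apply: coded_cover_null (hN n); rewrite addnS.
Qed.

End Angles.

Local Open Scope ereal_scope.

Theorem proposition2p10 (R : realType) :
  (forall M : nat, (2 <= M)%N ->
     hausdorff_dim (renormalizable_angles M : set (circle R)) <= (M%:R^-1)%:E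
     /\ sequence_dim R (renormalizable_sequences M) <= (M%:R^-1)%:E)
  /\ hausdorff_dim (infinitely_renormalizable_angles : set (circle R)) = 0
  /\ sequence_dim R infinitely_renormalizable_sequences = 0.
Proof.
split=> [M M2|]; [split|split].
- apply: hausdorff_dim_le => [|s hs]; first by rewrite invr_ge0.
  apply: hausdorff_measure0_subset (coded_cover_null _ hs); last exact: ltnW.
  by move=> theta [_ /renormalizable_angle_coded].
- apply: hausdorff_dim_le => [|s hs]; first by rewrite invr_ge0.
  apply: hausdorff_measure0_subset (coded_cover_null _ hs); last exact: ltnW.
  by move=> _ [x [_ /renormalizable_sequence_coded h] <-].
- apply: infinite_cover_dim => N theta [_ /(_ N)[M [NM /renormalizable_angle_coded h]]].
  by exists (M - N)%N => //; rewrite subnK.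
- apply: infinite_cover_dim => N _ [x [_ /(_ N)[M [NM /renormalizable_sequence_coded h]]] <-].
  by exists (M - N)%N => //; rewrite subnK.
Qed.
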